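(* Let $(X,\mathcal F,\mu)$ be a $\sigma$-finite measure space, let $C_\varphi$ and $C_\psi$ be composition operators on $L^2(\mu)$, with $C_\psi$ positive. Put $J:=h_\varphi\cdot E^\varphi(\sqrt{h_\psi})\circ\varphi^{-1}$ and $S_J=\{x\in X:J(x)\ne0\}$. Then $C_\varphi$ is $C_\psi$-selfadjoint if and only if the restricted map $\varphi|_{S_J}$ is periodic of period two and $$J=\sqrt{h_\psi}\quad\text{a.e.}$$
   Context: The maps $\varphi,\psi:X\to X$ are measurable and non-singular ($\mu\circ\varphi^{-1}\ll\mu$, $\mu\circ\psi^{-1}\ll\mu$), and $C_\varphi f=f\circ\varphi$, $C_\psi f=f\circ\psi$ are assumed bounded on $L^2(\mu)$. ''$C_\psi$ positive'' means $\langle C_\psi f,f\rangle\ge0$ for all $f\in L^2(\mu)$. $h_\varphi=\frac{d(\mu\circ\varphi^{-1})}{d\mu}$ and $h_\psi=\frac{d(\mu\circ\psi^{-1})}{d\mu}$. $E^\varphi(f)=E(f\mid\varphi^{-1}(\mathcal F))$ is the conditional expectation with respect to $\varphi^{-1}(\mathcal F)$ and $\mu$ (defined for $f\in L^2(\mu)$ and for nonnegative measurable $f$). $E^\varphi(f)\circ\varphi^{-1}$ denotes the measurable function $g$, unique a.e. on $\{h_\varphi\ne0\}$ and taken to be $0$ elsewhere, with $g\circ\varphi=E^\varphi(f)$ a.e. ''$\varphi|_{S_J}$ is periodic of period two'' means $\varphi(\varphi(x))=x$ for a.e. $x\in S_J$. For a positive bounded operator $A$, a bounded operator $T$ is $A$-selfadjoint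 if $\langle ATf,g\rangle=\langle Af,Tg\rangle$ for all $f,g$, i.e. $AT=T^*A$.
   Formalization: The measure space is also assumed to have, off a null set, countably many measurable sets separating points; without this the claim fails (e.g. trivial σ-algebra on three points, ψ the identity, φ a 3-cycle). *)

(* Defs.v *)
From HB Require Import structures.
From mathcomp Require Import all_boot all_order all_algebra.
From mathcomp Require Import all_classical all_reals all_analysis.
From mathcomp Require Import complex.

Set Implicit Arguments.
Unset Strict Implicit.
Unset Printing Implicit Defensive.

Import Order.TTheory GRing.Theory Num.Theory.
Import numFieldNormedType.Exports.

Local Open Scope classical_set_scope.
Local Open Scope ring_scope.

(* Elements of the complex Hilbert space L^2(mu) are represented by functions
   X -> R[i]; operators act on representatives. The scalars are complex:
   positivity of an operator is meant in the complex sense, where it entails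
   selfadjointness. *)
Section L2.
Context (d : measure_display) (X : measurableType d) (R : realType).
Variable mu : {measure set X -> \bar R}.
Implicit Types (f g : X -> R[i]) (T A : (X -> R[i]) -> (X -> R[i])).

Definition L2norm f : \bar R :=
  ('N[mu]_2%:E[EFin \o @Normc.normc R \o f])%E.

Definition inL2 f : Prop :=
  [/\ measurable_fun setT (fun x => complex.Re (f x)),
      measurable_fun setT (fun x => complex.Im (f x)) &
      (L2norm f < +oo)%E].

Definition cintegral f : R[i] :=
  Complex (Rintegral mu setT (fun x => complex.Re (f x)))
          (Rintegral mu setT (fun x => complex.Im (f x))).

Definition inner f g : R[i] := cintegral (fun x => f x * conjc (g x)).

Definition bounded_op T : Prop :=
  exists M : R, forall f, inL2 f ->
    inL2 (T f) /\ (L2norm (T f) <= M%:E * L2norm f)%E.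

(* In the order of R[i], 0 <= z says that z is real and nonnegative. *)
Definition positive_op T : Prop := forall f, inL2 f -> 0 <= inner (T f) f.

Definition selfadjoint_wrt A T : Prop :=
  forall f g, inL2 f -> inL2 g -> inner (A (T f)) g = inner (A f) (T g).

End L2.

Definition comp_op (X C : Type) (phi : X -> X) (f : X -> C) : X -> C := f \o phi.

Section composition.
Context (d : measure_display) (X : measurableType d) (R : realType).
Variable mu : {measure set X -> \bar R}.
Implicit Types (phi : X -> X) (f h E g : X -> R).

Definition nonsingular phi : Prop :=
  measurable_fun setT phi /\ pushforward mu phi `<< mu.

(* h is a version of d(mu \o phi^-1)/dmu. It is real-valued: when C_phi is
   bounded on L^2(mu), mu \o phi^-1 is dominated by a multiple of mu, so a
   finite version exists. The library's Radon-Nikodym derivative does not apply,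
   because mu \o phi^-1 need not be finite. *)
Definition is_RN_derivative phi h : Prop :=
  [/\ measurable_fun setT h, forall x, 0 <= h x &
      forall A, measurable A ->
        pushforward mu phi A = (\int[mu]_(x in A) (h x)%:E)%E].

(* E is a version of the conditional expectation of the nonnegative function f
   with respect to phi^-1(F) and mu. *)
Definition is_cond_exp phi f E : Prop :=
  [/\ measurable_fun setT (E : g_sigma_algebra_preimageType phi -> R),
      forall x, 0 <= E x &
      forall B, g_sigma_algebra_preimage phi B ->
        (\int[mu]_(x in B) (E x)%:E = \int[mu]_(x in B) (f x)%:E)%E].

(* g is E \o phi^-1, where h is d(mu \o phi^-1)/dmu *)
Definition is_comp_inverse phi h E g : Prop :=
  [/\ measurable_fun setT g, g \o phi = E %[ae mu] &
      forall x, h x = 0 -> g x = 0].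

Definition periodic_two_on phi (S : set X) : Prop :=
  {ae mu, forall x, S x -> phi (phi x) = x}.

(* Up to a null set, countably many measurable sets separate the points. This
   holds for example when X is standard Borel. An operator on L^2(mu) only sees
   phi up to its action on measurable sets modulo null sets; without such a
   condition it does not determine phi pointwise a.e. (on the trivial
   sigma-algebra every map phi has C_phi equal to the identity). *)
Definition countably_separated : Prop :=
  exists (A : nat -> set X) (N : set X),
    [/\ forall n, measurable (A n), mu.-negligible N &
        forall x y, ~ N x -> ~ N y -> (forall n, A n x <-> A n y) -> x = y].

End composition.

(* Main.v *)
Require Import Defs.
From mathcomp Require Import all_boot all_order all_algebra.
From mathcomp Require Import all_classical all_reals all_analysis.
From mathcomp Require Import measurable_realfun complex lra ring.

Import Order.TTheory GRing.Theory Num.Theory.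
Import numFieldNormedType.Exports.

Local Open Scope classical_set_scope.
Local Open Scope ring_scope.

(** A positive composition operator is the identity, and this trivialises the
weight [J].

Positivity over the complex scalars makes [C_psi] selfadjoint, which on
indicators reads [mu (psi^-1 A & B) = mu (A & psi^-1 B)]. Letting [B] increase
to the whole space gives [mu (psi^-1 A) = mu A], so [C_psi] is a selfadjoint
isometry, hence [C_psi ^ 2 = 1]. For [u = C_psi f - f] this yields
[<C_psi u, u> = - |u|^2], so positivity forces [C_psi f = f]
([positive_comp_invariant]). Since countably many sets separate the points up
to a null set, a map that preserves all measurable sets mod 0 is the identity
a.e. ([ae_id_of_invariant_sets]); thus [psi x = x] a.e. and [h_psi = 1] a.e.

It follows that [E^phi (sqrt h_psi) = 1], so [J = h_phi] a.e.
([RN_mul_comp_inverse_eq]), and being [C_psi]-selfadjoint is plain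
selfadjointness ([selfadjoint_wrt_ae_id]). What remains is that [C_phi] is
selfadjoint iff [phi] preserves [mu] and [phi (phi x) = x] a.e.
([selfadjoint_compP]): for the direct implication, [C_phi] is again a
selfadjoint isometry, so [C_phi ^ 2 = 1] and the separation of points applies to
[phi o phi]; the converse is the substitution [x := phi x] in [<f, C_phi g>].
Finally [phi] preserves [mu] iff [h_phi = 1] a.e., i.e. iff [J = sqrt h_psi]
a.e., and then [S_J] has a null complement. *)

(** * Symmetric maps and maps that preserve sets mod 0 *)

Section mod_null_sets.
Context {R : realType} {d : measure_display} {X : measurableType d}.
Variable mu : {sigma_finite_measure set X -> \bar R}.
Implicit Types (A B : set X) (tau : X -> X).

Local Lemma measurable_preimageT tau A :
  measurable_fun setT tau -> measurable A -> measurable (tau @^-1` A).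
Proof. by move=> mtau mA; rewrite -[_ @^-1` _]setTI; exact: mtau. Qed.

Lemma measure_setI_lty A B : measurable A -> measurable B ->
  (mu B < +oo)%E -> (mu (A `&` B) < +oo)%E.
Proof. by move=> mA mB; apply: le_lt_trans; rewrite measureIr. Qed.

Lemma cvg_measure_setI_exhaustion (F : (set X)^nat) A :
  setT = \bigcup_i F i -> nondecreasing_seq F ->
  (forall i, measurable (F i)) -> measurable A ->
  mu (A `&` F n) @[n --> \oo] --> mu A.
Proof.
move=> FT ndF mF mA; rewrite -[X in _ --> mu X]setIT FT setI_bigcupr.
apply: (nondecreasing_cvg_mu (F := fun n => A `&` F n)).
- by move=> i; exact: measurableI.
- by apply: bigcupT_measurable => i; exact: measurableI.
- move=> i j ij; apply/subsetPset; apply: setIS.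
  by apply/subsetPset; exact: ndF.
Qed.

Definition measure_preserving tau :=
  forall A, measurable A -> mu (tau @^-1` A) = mu A.

(** Selfadjointness of the composition operator of [tau], tested on
indicators. *)
Definition symmetric_map tau :=
  forall A B, measurable A -> measurable B ->
    (mu A < +oo)%E -> (mu B < +oo)%E ->
    mu (tau @^-1` A `&` B) = mu (A `&` tau @^-1` B).

(** For [A] of finite measure, let [B] exhaust the space by sets of finite
measure in the symmetry relation: both [B] and [tau^-1 B] increase to
the whole space, so the two sides tend to [mu (tau^-1 A)] and [mu A]. A second
exhaustion removes the finiteness of [mu A]. *)
Lemma symmetric_map_preserving tau : measurable_fun setT tau ->
  symmetric_map tau -> measure_preserving tau.
Proof.
move=> mtau stau.
have /sigma_finiteP[F [FT ndF mF]] := sigma_finiteT mu.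
have FmF i : measurable (F i) by have [] := mF i.
have cvg_preimageF A : measurable A ->
    mu (A `&` tau @^-1` F n) @[n --> \oo] --> mu A.
  move=> mA.
  apply: (cvg_measure_setI_exhaustion (fun n => tau @^-1` F n)) => //.
  - by rewrite -preimage_bigcup -FT.
  - move=> i j ij; apply/subsetPset; apply: preimage_subset.
    by apply/subsetPset; exact: ndF.
  - by move=> i; exact: measurable_preimageT.
have finA A : measurable A -> (mu A < +oo)%E -> mu (tau @^-1` A) = mu A.
  move=> mA Afin.
  have := cvg_measure_setI_exhaustion _ _ FT ndF FmF
    (measurable_preimageT _ _ mtau mA).
  under eq_cvg do rewrite stau// ?(mF _).2//.
  by move=> /cvg_lim <- //; apply/cvg_lim => //; exact: cvg_preimageF.
move=> A mA.
have := cvg_preimageF _ (measurable_preimageT _ _ mtau mA).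
under eq_cvg => n.
  rewrite -preimage_setI finA//; [|exact: measurableI|]; last first.
    exact: measure_setI_lty (mF n).2.
  over.
move=> /cvg_lim <- //; apply/cvg_lim => //.
exact: cvg_measure_setI_exhaustion.
Qed.

(** The square of a selfadjoint isometry is the identity: on indicators,
[mu (A & tau^-1 (tau^-1 A)) = mu (tau^-1 A & tau^-1 A) = mu A]. *)
Lemma symmetric_map_invol tau A : measurable_fun setT tau ->
  symmetric_map tau -> measurable A -> (mu A < +oo)%E ->
  mu (A `\` (tau \o tau) @^-1` A) = 0.
Proof.
move=> mtau stau mA Afin.
have mt := measurable_preimageT _ _ mtau.
have ptau := symmetric_map_preserving _ mtau stau.
have inter : mu (A `&` (tau \o tau) @^-1` A) = mu A.
  rewrite comp_preimage -stau//; [|exact: mt|by rewrite ptau].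
  by rewrite setIid ptau.
rewrite measureD//; last by rewrite comp_preimage; exact/mt/mt.
transitivity (mu A - mu A)%E; first by congr (_ - _)%E.
by rewrite subee// ge0_fin_numE.
Qed.

(** The inclusion of [A] in [tau^-1 A] mod 0 extends from sets of finite measure
to all measurable sets by sigma-finiteness, in particular to each separating set
and to its complement: a.e. [x] and [tau x] are not separated. Preservation of
[mu] keeps [tau x] outside of the exceptional null set. *)
Lemma ae_id_of_invariant_sets tau : countably_separated mu ->
  measurable_fun setT tau -> measure_preserving tau ->
  (forall A, measurable A -> (mu A < +oo)%E -> mu (A `\` tau @^-1` A) = 0) ->
  {ae mu, forall x, tau x = x}.
Proof.
move=> [A [N [mA [N' [mN' N'0 NN']] sep]]] mtau ptau inv.
have mt B := measurable_preimageT _ B mtau.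
have [F FT mF] := sigma_finiteT mu.
(* Splitting along the sets of finite measure [F n] covers the complements of
   the separating sets, whose measure may be infinite. *)
have inv' B : measurable B -> {ae mu, forall x, B x -> B (tau x)}.
  move=> mB.
  suff : {ae mu, forall x, forall n, (B `&` F n) x -> B (tau x)}.
    apply: filterS => x h Bx.
    have : setT x by [].
    by rewrite FT => -[n _ Fnx]; exact: (h n).
  apply: ae_foralln => n; have [mFn Fn] := mF n.
  have mBF : measurable (B `&` F n) by exact: measurableI.
  exists ((B `&` F n) `\` tau @^-1` (B `&` F n)); split.
  - by apply: measurableD => //; exact: mt.
  - apply: inv => //; apply: le_lt_trans Fn.
    by rewrite measureIr.
  - move=> x /= /not_implyP[BFx nB]; split=> //.
    by move=> [].
have aeA : {ae mu, forall x, forall n, A n x -> A n (tau x)}.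
  by apply: ae_foralln => n; exact: inv'.
have aeCA : {ae mu, forall x, forall n, ~ A n x -> ~ A n (tau x)}.
  by apply: ae_foralln => n; apply: (inv' (~` A n)); exact: measurableC.
have aeN : {ae mu, forall x, ~ N x}.
  by exists N'; split => // x /= /contrapT; exact: NN'.
have aetN : {ae mu, forall x, ~ N (tau x)}.
  exists (tau @^-1` N'); split; [exact: mt|by rewrite ptau|].
  by move=> x /= /contrapT; exact: NN'.
near=> x.
apply: sep; [by near: x|by near: x|move=> n; split].
- by apply: contraPP; move: n; near: x.
- by move: n; near: x.
Unshelve. all: by end_near. Qed.

Lemma density_eq1 (nu : {measure set X -> \bar R}) (h : X -> R) :
  sigma_finite setT nu -> measurable_fun setT h ->
  (forall A, measurable A -> (\int[nu]_(x in A) (h x)%:E)%E = nu A) ->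
  h = cst 1 %[ae nu].
Proof.
move=> [F FT mF] mh hA.
suff : {ae nu, forall x, forall n, F n x -> h x = 1}.
  apply: filterS => x hx _; have : setT x by [].
  by rewrite FT => -[n _ Fnx]; exact: (hx n).
apply: ae_foralln => n; have [mFn Fn] := mF n.
have : ae_eq nu (F n) (cst 1%E) (EFin \o h).
  apply: integral_ae_eq => //.
  - apply/integrableP; split; first exact: measurable_cst.
    under eq_integral do rewrite /= normr1.
    by rewrite integral_cst// mul1e.
  - by apply/measurable_EFinP; exact: measurable_funTS.
  - by move=> E _ mE; rewrite hA// integral_cst// mul1e.
by apply: filterS => x /[apply] /= -[->].
Qed.

End mod_null_sets.

(** * Positive composition operators *)

Section L2.
Context {R : realType} {d : measure_display} {X : measurableType d}.
Variable mu : {sigma_finite_measure set X -> \bar R}.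
Implicit Types (A B D : set X) (tau phi : X -> X) (a b : X -> R).

(** The source of test functions: finite combinations of indicators of sets of
finite measure. *)
Lemma inL2_bounded D a b : measurable D -> (mu D < +oo)%E ->
  measurable_fun setT a -> measurable_fun setT b ->
  (forall x, `|a x| <= \1_D x) -> (forall x, `|b x| <= \1_D x) ->
  inL2 mu (fun x => Complex (a x) (b x)).
Proof.
move=> mD Dfin ma mb aD bD; split => //.
rewrite /L2norm unlock.
apply: poweR_lty.
rewrite (eq_integral (fun x => (a x ^+ 2 + b x ^+ 2)%:E)); last first.
  move=> x _.
  change ((`|Num.sqrt (a x ^+ 2 + b x ^+ 2)| `^ 2)%:E =
          (a x ^+ 2 + b x ^+ 2)%:E).
  rewrite ger0_norm ?sqrtr_ge0//.
  by rewrite powR_mulrn ?sqrtr_ge0// sqr_sqrtr// addr_ge0// sqr_ge0.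
apply: (@le_lt_trans _ _ (\int[mu]_x (2 * \1_D x)%:E)%E); last first.
  under eq_integral do rewrite EFinM.
  rewrite ge0_integralZl//=.
  - rewrite integral_indic// setIT.
    by apply: lte_mul_pinfty.
  - by apply/measurable_EFinP; exact: measurable_indic.
apply: ge0_le_integral => //.
- by move=> x _; rewrite lee_fin addr_ge0// sqr_ge0.
- by apply/measurable_EFinP; apply: measurable_funD => //;
    exact: measurable_funX.
- by apply/measurable_EFinP; apply: measurable_funM => //;
    exact: measurable_indic.
- move=> x _ /=; rewrite lee_fin -(real_normK (num_real (a x))).
  rewrite -(real_normK (num_real (b x))).
  have := aD x; have := bD x; rewrite indicE.
  case: (x \in D) => /= hb ha; have := normr_ge0 (a x); have := normr_ge0 (b x);
    nra.
Qed.

Lemma innerE f g : inner mu f g =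
  Complex
    (Rintegral mu setT (fun x => complex.Re (f x) * complex.Re (g x) +
                                 complex.Im (f x) * complex.Im (g x)))
    (Rintegral mu setT (fun x => complex.Im (f x) * complex.Re (g x) -
                                 complex.Re (f x) * complex.Im (g x))).
Proof.
rewrite /inner /cintegral; congr Complex; apply: eq_Rintegral => x _;
  by case: (f x) (g x) => a b [u v] /=; ring.
Qed.

Lemma integrable_finite_indic A : measurable A -> (mu A < +oo)%E ->
  mu.-integrable setT (EFin \o (\1_A : X -> R)).
Proof.
move=> mA Afin; apply/integrableP; split.
  by apply/measurable_EFinP; exact: measurable_indic.
under eq_integral do rewrite /= ger0_norm//.
by rewrite integral_indic// setIT.
Qed.

Lemma Rintegral_indic A : measurable A ->
  Rintegral mu setT (\1_A : X -> R) = fine (mu A).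
Proof. by move=> mA; rewrite /Rintegral integral_indic// setIT. Qed.

(** For [f = 1_A + i 1_B] the imaginary part of [<C_tau f, f>] is
[mu (tau^-1 B & A) - mu (tau^-1 A & B)]; it vanishes because positivity
includes being real. *)
Lemma positive_comp_symmetric tau : measurable_fun setT tau ->
  positive_op mu (comp_op tau) -> symmetric_map mu tau.
Proof.
move=> mtau pos A B mA mB Afin Bfin.
have mt C : measurable C -> measurable (tau @^-1` C).
  exact: measurable_preimageT.
have mAB : measurable (A `|` B) by exact: measurableU.
pose f := fun x => Complex (\1_A x : R) (\1_B x).
have fL2 : inL2 mu f.
  apply: (inL2_bounded (A `|` B)) => //; try exact: measurable_indic.
  - apply: le_lt_trans (measureU2 _ _ _) _ => //.
    exact: lte_add_pinfty.
  - by move=> x; rewrite !indicE in_setU; case: (x \in A); case: (x \in B);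
    rewrite /= ?normr1 ?normr0 ?ler01.
  - by move=> x; rewrite !indicE in_setU; case: (x \in A); case: (x \in B);
    rewrite /= ?normr1 ?normr0 ?ler01.
have := pos f fL2; rewrite innerE lecE => /andP[/= /eqP + _].
under eq_Rintegral => x _.
  rewrite (_ : _ - _ = \1_(tau @^-1` B `&` A) x - \1_(tau @^-1` A `&` B) x).
    over.
  by rewrite !indicI.
rewrite RintegralB//; last 2 first.
- by apply: integrable_finite_indic; [apply: measurableI => //; exact: mt|
    apply: measure_setI_lty => //; exact: mt].
- by apply: integrable_finite_indic; [apply: measurableI => //; exact: mt|
    apply: measure_setI_lty => //; exact: mt].
rewrite !Rintegral_indic; try (apply: measurableI => //; exact: mt).
move=> /subr0_eq e.
have fin C D : measurable C -> measurable D -> (mu D < +oo)%E ->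
    mu (C `&` D) \is a fin_num.
  by move=> mC mD Dfin; rewrite ge0_fin_numE// measure_setI_lty.
rewrite [in RHS]setIC -[LHS]fineK; last by apply: fin => //; exact: mt.
by rewrite -[RHS]fineK; [rewrite e|apply: fin => //; exact: mt].
Qed.

(** With [A1 = tau^-1 A] and [A2 = tau^-1 A1], positivity at [1_A1 - 1_A] reads
[mu (A2 & A1) - mu (A2 & A) - mu A1 + mu (A1 & A) >= 0]. Here
[mu (A2 & A1) = mu (A1 & A)] and [mu A1 = mu A] since [tau] preserves [mu], and
[mu (A2 & A) = mu (A1 & A1) = mu A] by symmetry. Hence
[mu (A1 & A) >= mu A]. *)
Lemma positive_comp_invariant tau A : measurable_fun setT tau ->
  positive_op mu (comp_op tau) -> measurable A -> (mu A < +oo)%E ->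
  mu (A `\` tau @^-1` A) = 0.
Proof.
move=> mtau pos mA Afin.
have mt C : measurable C -> measurable (tau @^-1` C).
  exact: measurable_preimageT.
have stau := positive_comp_symmetric _ mtau pos.
have ptau := symmetric_map_preserving _ _ mtau stau.
set A1 := tau @^-1` A; set A2 := tau @^-1` A1.
have mA1 : measurable A1 by exact: mt.
have mA2 : measurable A2 by exact: mt.
have A1fin : (mu A1 < +oo)%E by rewrite ptau.
have finI C : measurable C -> mu (C `&` A) \is a fin_num.
  by move=> mC; rewrite ge0_fin_numE// measure_setI_lty.
pose f := fun x => Complex (\1_A1 x - \1_A x : R) 0.
have fL2 : inL2 mu f.
  apply: (inL2_bounded (A1 `|` A)) => //.
  - exact: measurableU.
  - apply: le_lt_trans (measureU2 _ _ _) _ => //.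
    exact: lte_add_pinfty.
  - by apply: measurable_funB; exact: measurable_indic.
  - move=> x; rewrite !indicE in_setU; case: (x \in A1); case: (x \in A) => /=;
    by rewrite ?subrr ?subr0 ?sub0r ?normrN ?normr0 ?normr1.
  - by move=> x; rewrite normr0.
have := pos f fL2; rewrite innerE lecE => /andP[_ /=].
rewrite (_ : Rintegral _ _ _ = Rintegral mu setT (fun x =>
  (\1_(A2 `&` A1) x - \1_(A2 `&` A) x) + (\1_(A1 `&` A) x - \1_A1 x)));
    last first.
  apply: eq_Rintegral => x _; rewrite mul0r addr0.
  transitivity ((\1_A2 x - \1_A1 x) * (\1_A1 x - \1_A x) : R) => //.
  by rewrite !indicI /= !indicE; case: (x \in A1) => /=; ring.
have [i1 i2 i3 i4] : [/\
  mu.-integrable setT (EFin \o (\1_(A2 `&` A1) : X -> R)),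
  mu.-integrable setT (EFin \o (\1_(A2 `&` A) : X -> R)),
  mu.-integrable setT (EFin \o (\1_(A1 `&` A) : X -> R)) &
  mu.-integrable setT (EFin \o (\1_A1 : X -> R))].
  by split; apply: integrable_finite_indic => //;
    [exact: measurableI|exact: measure_setI_lty|exact: measurableI|
     exact: measure_setI_lty|
     exact: measurableI|exact: measure_setI_lty].
rewrite RintegralD//; last 2 first.
- exact: (integrableB measurableT i1 i2).
- exact: (integrableB measurableT i3 i4).
rewrite !RintegralB// !Rintegral_indic//; try exact: measurableI.
have -> : mu (A2 `&` A1) = mu (A1 `&` A).
  by rewrite -preimage_setI ptau//; exact: measurableI.
have -> : mu (A2 `&` A) = mu A by rewrite stau// setIid ptau.
rewrite ptau// => le1.
have AA1 : mu (A `&` A1) = mu A.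
  apply/eqP; rewrite eq_le measureIl//= [A `&` _]setIC.
  rewrite -(fineK (finI _ mA1)) -[leLHS]fineK ?ge0_fin_numE// lee_fin; lra.
rewrite measureD//; transitivity (mu A - mu A)%E; first by congr (_ - _)%E.
by rewrite subee// ge0_fin_numE.
Qed.

End L2.

(** * Selfadjoint composition operators *)

Section selfadjoint.
Context {R : realType} {d : measure_display} {X : measurableType d}.
Variable mu : {sigma_finite_measure set X -> \bar R}.
Implicit Types (A B D : set X) (tau phi : X -> X) (f g : X -> R[i]).

Definition cmeasurable f :=
  measurable_fun setT (fun x => complex.Re (f x)) /\
  measurable_fun setT (fun x => complex.Im (f x)).

Lemma inL2_cmeasurable f : inL2 mu f -> cmeasurable f.
Proof. by case. Qed.

Lemma cmeasurable_comp f tau : measurable_fun setT tau ->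
  cmeasurable f -> cmeasurable (f \o tau).
Proof.
by move=> mtau [mr mi]; split;
  [exact: (measurableT_comp mr)|exact: (measurableT_comp mi)].
Qed.

Lemma cmeasurable_mul_conj f g : cmeasurable f -> cmeasurable g ->
  cmeasurable (fun x => f x * conjc (g x)).
Proof.
move=> [fr fi] [gr gi]; split.
- rewrite (_ : (fun _ => _) = (fun x => complex.Re (f x) * complex.Re (g x) +
    complex.Im (f x) * complex.Im (g x))).
    by apply: measurable_funD; exact: measurable_funM.
  by apply/funext => x; case: (f x) (g x) => a b [u v] /=; ring.
- rewrite (_ : (fun _ => _) = (fun x => complex.Im (f x) * complex.Re (g x) -
    complex.Re (f x) * complex.Im (g x))).
    by apply: measurable_funB; exact: measurable_funM.
  by apply/funext => x; case: (f x) (g x) => a b [u v] /=; ring.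
Qed.

Lemma cintegral_ae f g : cmeasurable f -> cmeasurable g ->
  {ae mu, forall x, f x = g x} -> cintegral mu f = cintegral mu g.
Proof.
move=> [fr fi] [gr gi] fg; rewrite /cintegral /Rintegral.
congr (Complex (fine _) (fine _)).
- apply: ae_eq_integral => //; [exact/measurable_EFinP|exact/measurable_EFinP|].
  by apply: filterS fg => x /= ->.
- apply: ae_eq_integral => //; [exact/measurable_EFinP|exact/measurable_EFinP|].
  by apply: filterS fg => x /= ->.
Qed.

(** The change of variables for nonnegative functions applies to the positive and
negative parts, whose integrals determine that of [f], convergent or not. *)
Lemma cintegral_comp f tau : measurable_fun setT tau ->
  measure_preserving mu tau -> cmeasurable f ->
  cintegral mu (f \o tau) = cintegral mu f.
Proof.
move=> mtau ptau [fr fi].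
have ge0 (u : X -> \bar R) : measurable_fun setT u -> (forall x, 0 <= u x)%E ->
    (\int[mu]_x u (tau x) = \int[mu]_x u x)%E.
  move=> mu_ u0; transitivity (\int[pushforward mu tau]_x u x)%E.
    by rewrite ge0_integral_pushforward.
  by apply: eq_measure_integral => A mA _; exact: ptau.
have re (u : X -> R) : measurable_fun setT u ->
    Rintegral mu setT (u \o tau) = Rintegral mu setT u.
  move=> mu_; rewrite /Rintegral integralE [in RHS]integralE.
  have mE : measurable_fun setT (EFin \o u) by exact/measurable_EFinP.
  congr (fine (_ - _)).
  - rewrite -(ge0 (EFin \o u)^\+%E) => //; last exact: measurable_funepos.
    by apply: eq_integral => x _; rewrite !funeposE.
  - rewrite -(ge0 (EFin \o u)^\-%E) => //; last exact: measurable_funeneg.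
    by apply: eq_integral => x _; rewrite !funenegE.
by rewrite /cintegral; congr Complex; [exact: (re (fun x => complex.Re (f x)))|
  exact: (re (fun x => complex.Im (f x)))].
Qed.

Lemma selfadjoint_wrt_ae_id psi T : measurable_fun setT psi ->
  {ae mu, forall x, psi x = x} ->
  (forall f, inL2 mu f -> inL2 mu (T f)) ->
  selfadjoint_wrt mu (comp_op psi) T <-> selfadjoint_wrt mu id T.
Proof.
move=> mpsi psi1 TL2.
have inner_psi f g : inL2 mu f -> inL2 mu g ->
    inner mu (comp_op psi f) g = inner mu f g.
  move=> /inL2_cmeasurable mf /inL2_cmeasurable mg; apply: cintegral_ae.
  - by apply: cmeasurable_mul_conj => //; exact: cmeasurable_comp.
  - exact: cmeasurable_mul_conj.
  - by apply: filterS psi1 => x e; rewrite /comp_op /= e.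
split=> sT f g fL2 gL2; have := sT f g fL2 gL2; rewrite !inner_psi//;
  exact: TL2.
Qed.

Lemma selfadjoint_comp_symmetric phi : measurable_fun setT phi ->
  selfadjoint_wrt mu id (comp_op phi) -> symmetric_map mu phi.
Proof.
move=> mphi sphi A B mA mB Afin Bfin.
have mt C : measurable C -> measurable (phi @^-1` C).
  exact: measurable_preimageT.
pose f (C : set X) := fun x => Complex (\1_C x : R) 0.
have fL2 C : measurable C -> (mu C < +oo)%E -> inL2 mu (f C).
  move=> mC Cfin; apply: (inL2_bounded _ C) => //.
  - by move=> x; rewrite indicE ger0_norm.
  - by move=> x; rewrite normr0.
have inner_f C D : measurable C -> measurable D ->
    inner mu (f C) (f D) = Complex (fine (mu (C `&` D))) 0.
  move=> mC mD; rewrite innerE -Rintegral_indic; last exact: measurableI.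
  congr Complex.
    apply: eq_Rintegral => x _.
    by rewrite /= mul0r addr0 !indicE in_setI -mulnb natrM.
  transitivity (Rintegral mu setT (cst 0)).
    by apply: eq_Rintegral => x _; rewrite /= mul0r mulr0 subr0.
  by rewrite /Rintegral integral0.
have := sphi (f A) (f B) (fL2 _ mA Afin) (fL2 _ mB Bfin).
rewrite -[comp_op phi (f A)]/(f (phi @^-1` A)).
rewrite -[comp_op phi (f B)]/(f (phi @^-1` B)).
rewrite !inner_f//; [|exact: mt|exact: mt] => -[e].
rewrite -[LHS]fineK; last first.
  by rewrite ge0_fin_numE// measure_setI_lty//; exact: mt.
rewrite e fineK// ge0_fin_numE//.
by apply: le_lt_trans Afin; rewrite measureIl//; exact: mt.
Qed.

(** A selfadjoint [C_phi] gives a symmetric map, whose square fixes all sets mod 0.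
Conversely, if [phi o phi] is the identity a.e., then [<f o phi, g>] is the
integral of [(f * conj (g o phi)) o phi], and [phi] preserves [mu]. *)
Lemma selfadjoint_compP phi : countably_separated mu ->
  measurable_fun setT phi ->
  selfadjoint_wrt mu id (comp_op phi) <->
  measure_preserving mu phi /\ {ae mu, forall x, phi (phi x) = x}.
Proof.
move=> sep mphi; split=> [sphi|[pphi phi2] f g].
  have sym := selfadjoint_comp_symmetric _ mphi sphi.
  have pphi := symmetric_map_preserving _ _ mphi sym.
  split=> //; apply: (ae_id_of_invariant_sets mu (phi \o phi)) => //.
  - exact: measurableT_comp.
  - move=> A mA; rewrite comp_preimage !pphi//.
    exact: measurable_preimageT.
  - by move=> A mA Afin; exact: symmetric_map_invol.
move=> /inL2_cmeasurable mf /inL2_cmeasurable mg.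
have mgphi : cmeasurable (g \o phi) by exact: cmeasurable_comp.
rewrite /inner /= -[RHS](cintegral_comp _ phi) //; last first.
  exact: cmeasurable_mul_conj.
apply: cintegral_ae.
- by apply: cmeasurable_mul_conj => //; exact: cmeasurable_comp.
- by apply: cmeasurable_comp => //; exact: cmeasurable_mul_conj.
- by apply: filterS phi2 => x e; rewrite /comp_op /= e.
Qed.

End selfadjoint.

(** * Densities and conditional expectations *)

Section densities.
Context {R : realType} {d : measure_display} {X : measurableType d}.
Variable mu : {sigma_finite_measure set X -> \bar R}.
Implicit Types (phi : X -> X) (f h E g : X -> R).

Lemma RN_derivative_eq1P phi h : is_RN_derivative mu phi h ->
  measure_preserving mu phi <-> h = cst 1 %[ae mu].
Proof.
move=> [mh h0 hA]; split=> [pphi|h1 A mA].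
  by apply: density_eq1 => //; [exact: sigma_finiteT|move=> A mA];
    rewrite -hA//; exact: pphi.
transitivity (\int[mu]_(x in A) (h x)%:E)%E; first exact: hA.
rewrite (ae_eq_integral (cst 1%E)) //.
- by rewrite integral_cst// mul1e.
- by apply/measurable_EFinP; exact: measurable_funTS.
- by apply: filterS h1 => x /= + _ => ->.
Qed.

(** The density is finite everywhere, so an exhausting sequence [G n] for [mu]
still covers the space when cut down to [h <= n], where [mu o phi^-1] is at most
[n] times [mu]. *)
Lemma sigma_finite_RN phi h : measurable_fun setT phi ->
  is_RN_derivative mu phi h -> sigma_finite setT (pushforward mu phi).
Proof.
move=> mphi [mh h0 hA].
have /sigma_finiteP[G [GT ndG mG]] := sigma_finiteT mu.
have mhn (n : nat) : measurable [set x | h x <= n%:R].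
  rewrite -[X in measurable X]setTI.
  exact: measurable_fun_le.
exists (fun n => G n `&` [set x | h x <= n%:R]).
  apply/esym; rewrite -subTset => x _; have : setT x by [].
  rewrite GT => -[n _ Gnx].
  pose m := maxn n (Num.bound (h x)).
  exists m => //; split.
    have : (G n `<=` G m) by apply/subsetPset; apply: ndG; exact: leq_maxl.
    exact.
  rewrite /=; apply: (@le_trans _ _ (Num.bound (h x))%:R).
    exact/ltW/archi_boundP.
  by rewrite ler_nat leq_maxr.
move=> n; have [mGn Gnfin] := mG n.
have mI : measurable (G n `&` [set x | h x <= n%:R]) by exact: measurableI.
split=> //; rewrite hA//; set D := _ `&` _.
apply: (@le_lt_trans _ _ (\int[mu]_(x in D) (n%:R : R)%:E)%E).
  apply: ge0_le_integral => //.
  - by move=> x _; rewrite lee_fin.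
  - by apply/measurable_EFinP; exact: measurable_funTS.
  - by move=> x [_ hx]; rewrite lee_fin.
rewrite integral_cst//; apply: lte_mul_pinfty => //.
by apply: le_lt_trans Gnfin; rewrite measureIl.
Qed.

(** If [f = 1] a.e., its conditional expectation [g o phi] integrates like [1]
over each [phi^-1 A]; by change of variables [g] integrates like [1] against
[mu o phi^-1], so the set [g <> 1] is null for [mu o phi^-1], i.e. [h = 0] a.e.
on it. *)
Lemma RN_mul_comp_inverse_eq phi h f E g : measurable_fun setT phi ->
  is_RN_derivative mu phi h -> f = cst 1 %[ae mu] -> measurable_fun setT f ->
  is_cond_exp mu phi f E -> is_comp_inverse mu phi h E g ->
  (fun x => h x * g x) = h %[ae mu].
Proof.
move=> mphi hP f1 mf [mE E0 EB] [mg gE gh0].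
have sf := sigma_finite_RN _ _ mphi hP; have [mh h0 hA] := hP.
unshelve epose (nu := [the {measure set X -> \bar R} of pushforward mu phi]).
  exact: mphi.
have mt C : measurable C -> measurable (phi @^-1` C).
  exact: measurable_preimageT.
have mE' : measurable_fun setT E.
  move=> _ Y mY; have [B mB <-] := mE measurableT Y mY.
  by rewrite setTI; exact: mt.
(* The sign of [g] is known only almost everywhere for [mu o phi^-1]; the positive
   part makes the change of variables applicable, and it equals 1 exactly where
   [g] does. *)
pose g' x := Num.max (g x) 0.
have mg' : measurable_fun setT g' by exact: measurable_maxr.
have g'1 : g' = cst 1 %[ae nu].
  apply: density_eq1 => // A mA.
  rewrite ge0_integral_pushforward//; last 2 first.
  - by apply/measurable_EFinP; exact: measurable_funTS.
  - by move=> x _; rewrite lee_fin le_max lexx orbT.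
  rewrite (ae_eq_integral (EFin \o E)) //; last 4 first.
  - exact: mt.
  - apply/measurable_EFinP; apply: measurable_funTS.
    exact: measurableT_comp.
  - by apply/measurable_EFinP; exact: measurable_funTS.
  - apply: filterS gE => x /(_ I) /= gEx _; rewrite /g' gEx; congr EFin.
    exact/max_idPl.
  transitivity (\int[mu]_(x in phi @^-1` A) (f x)%:E)%E.
    by apply: EB; exists A => //; rewrite setTI.
  rewrite (ae_eq_integral (cst 1%E)) //.
  - by rewrite integral_cst// ?mul1e//; exact: mt.
  - exact: mt.
  - by apply/measurable_EFinP; exact: measurable_funTS.
  - by apply: filterS f1 => x /(_ I) /= -> _.
pose B := ~` (g @^-1` [set 1]).
have mB : measurable B.
  by apply: measurableC; rewrite -[X in measurable X]setTI; exact: mg.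
have B0 : (\int[mu]_(x in B) `|(h x)%:E| = 0)%E.
  under eq_integral do rewrite gee0_abs ?lee_fin//.
  rewrite -hA//; apply: (measure_negligible (mu := nu)) => //.
  apply: negligibleS g'1 => x /= gx1 /(_ I) g'x1; apply: gx1 => /=.
  move: g'x1; rewrite /g' /cst; case: (leP 0 (g x)) => [//|_ /eqP].
  by rewrite eq_sym oner_eq0.
have : ae_eq mu B (EFin \o h) (cst 0%E).
  apply/ae_eq_integral_abs => //.
  by apply/measurable_EFinP; exact: measurable_funTS.
apply: filterS => x /= hx _; have [->|gx] := eqVneq (g x) 1.
  by rewrite mulr1.
have [->] : (h x)%:E = 0%E by apply: hx => /= /eqP; rewrite (negbTE gx).
by rewrite mul0r.
Qed.

End densities.

Theorem theorem2p9 (R : realType) (d : measure_display) (X : measurableType d)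
    (mu : {sigma_finite_measure set X -> \bar R})
    (mu_sep : countably_separated mu)
    (phi psi : X -> X)
    (phi_ns : nonsingular mu phi) (psi_ns : nonsingular mu psi)
    (phi_bd : bounded_op mu (comp_op phi))
    (psi_bd : bounded_op mu (comp_op psi))
    (psi_pos : positive_op mu (comp_op psi))
    (h_phi h_psi E g : X -> R)
    (h_phiP : is_RN_derivative mu phi h_phi)
    (h_psiP : is_RN_derivative mu psi h_psi)
    (EP : is_cond_exp mu phi (fun x => Num.sqrt (h_psi x)) E)
    (gP : is_comp_inverse mu phi h_phi E g) :
  let J := fun x => h_phi x * g x in
  let S_J := [set x | J x != 0] in
  selfadjoint_wrt mu (comp_op psi) (comp_op phi) <->
  (periodic_two_on mu phi S_J /\
   J = (fun x => Num.sqrt (h_psi x)) %[ae mu]).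
Proof.
move=> J S_J.
have [mphi _] := phi_ns; have [mpsi _] := psi_ns.
have psi_pres : measure_preserving mu psi.
  by apply: symmetric_map_preserving => //; exact: positive_comp_symmetric.
have psi1 : {ae mu, forall x, psi x = x}.
  by apply: ae_id_of_invariant_sets => // A; exact: positive_comp_invariant.
have sqrt1 : (fun x => Num.sqrt (h_psi x)) = cst 1 %[ae mu].
  have := (RN_derivative_eq1P mu _ _ h_psiP).1 psi_pres.
  by apply: filterS => x /= /[apply] ->; rewrite sqrtr1.
have msqrt : measurable_fun setT (fun x => Num.sqrt (h_psi x)).
  have [mh _ _] := h_psiP; apply: measurableT_comp mh.
  by apply: continuous_measurable_fun => x; exact: sqrt_continuous.
have Jh : J = h_phi %[ae mu].
  exact: RN_mul_comp_inverse_eq mphi h_phiP sqrt1 msqrt EP gP.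
have phi_L2 f : inL2 mu f -> inL2 mu (comp_op phi f).
  by have [M bd] := phi_bd => /bd[].
apply: (iff_trans (selfadjoint_wrt_ae_id mu _ _ mpsi psi1 phi_L2)).
apply: (iff_trans (selfadjoint_compP mu _ mu_sep mphi)).
have -> : measure_preserving mu phi <->
    J = (fun x => Num.sqrt (h_psi x)) %[ae mu].
  rewrite (RN_derivative_eq1P mu _ _ h_phiP); split=> h1.
  - by near=> x => _; rewrite (near Jh x)// (near h1 x)// (near sqrt1 x).
  - by near=> x => _; rewrite -(near Jh x)// (near h1 x)// (near sqrt1 x).
split=> [[J1 phi2]|[phi2 J1]]; split=> //.
- by apply: filterS phi2 => x ->.
- near=> x; have : S_J x -> phi (phi x) = x by near: x.
  apply; rewrite /S_J /= (near J1 x)// (near sqrt1 x)//.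
  exact: oner_neq0.
Unshelve. all: by end_near. Qed.
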